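(* Let $G$ be a graph on $n$ vertices and let $t \ge 2$. For each $T \in \mathcal{K}_t(G)$ define \[ \beta_G(T) = \max\{k : T \subseteq V(S) \text{ for some subgraph } S \subseteq G \text{ with } S \cong P_{k+1}\} \quad\text{and}\quad p_G(T) = \frac{1}{\binom{\beta_G(T)}{t-1}}. \] Then $p_G(T)$ is well-defined and decreasing in $\beta_G(T)$, and \[ \sum_{T \in \mathcal{K}_t(G)} p_G(T) \le \frac{n}{t}, \] with equality if and only if $G$ is a disjoint union of complete graphs, each of order at least $t$.
   Context: $P_{k+1}$ denotes the path with $k+1$ vertices and $k$ edges. For a graph $G$, $\mathcal{K}_t(G) = \{S \subseteq V(G) : G[S] \cong K_t\}$. Note that the path $S$ need only contain all vertices of $T$, not necessarily any edges of $G[T]$. *)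

(* Defs.v *)
From HB Require Import structures.
From mathcomp Require Import all_boot all_order all_algebra.
Set Implicit Arguments.
Unset Strict Implicit.
Unset Printing Implicit Defensive.
Import Order.TTheory GRing.Theory Num.Theory.

Record sgraph := SGraph {
  vertex :> finType;
  adj : rel vertex;
  adj_sym : symmetric adj;
  adj_irrefl : irreflexive adj }.

Definition iso (G H : sgraph) : bool :=
  [exists f : {ffun G -> H},
    [&& injectiveb f, [forall y, exists x, f x == y]
      & [forall x, forall y, adj (f x) (f y) == adj x y]]].

Lemma isoP (G H : sgraph) :
  reflect (exists f : G -> H,
             bijective f /\ forall x y, adj (f x) (f y) = adj x y)
          (iso G H).
Proof.
apply: (iffP existsP) => [[f /and3P[/injectiveP injf /forallP surf /forallP ef]]
                         | [f [[g fK gK] ef]]].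
  exists f; split=> [|x y]; last exact/eqP/(forallP (ef x)).
  pose g y := xchoose (existsP (surf y)).
  have gK : cancel g f by move=> y; exact/eqP/(xchooseP (existsP (surf y))).
  by exists g => // x; apply: injf; rewrite gK.
exists (finfun f); apply/and3P; split.
- by apply/injectiveP => x y; rewrite !ffunE => /(can_inj fK).
- by apply/forallP => y; apply/existsP; exists (g y); rewrite ffunE gK.
- by apply/forallP => x; apply/forallP => y; rewrite !ffunE ef.
Qed.

Section Complete.
Variable m : nat.
Definition complete_adj : rel 'I_m := fun i j => i != j.
Lemma complete_adj_sym : symmetric complete_adj.
Proof. by move=> i j; rewrite /complete_adj eq_sym. Qed.
Lemma complete_adj_irrefl : irreflexive complete_adj.
Proof. by move=> i; rewrite /complete_adj eqxx. Qed.
Definition complete_graph : sgraph :=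
  SGraph complete_adj_sym complete_adj_irrefl.
End Complete.

(* path_graph m has m vertices, hence m.-1 edges. *)
Section PathGraph.
Variable m : nat.
Definition path_adj : rel 'I_m :=
  fun i j => (i.+1 == j :> nat) || (j.+1 == i :> nat).
Lemma path_adj_sym : symmetric path_adj.
Proof. by move=> i j; rewrite /path_adj orbC. Qed.
Lemma path_adj_irrefl : irreflexive path_adj.
Proof. by move=> i; rewrite /path_adj orbb gtn_eqF. Qed.
Definition path_graph : sgraph := SGraph path_adj_sym path_adj_irrefl.
End PathGraph.

Section DisjointUnion.
Variables (I : finType) (F : I -> sgraph).
Definition du_adj : rel {i : I & F i} :=
  fun u v => (tag u == tag v) && adj (tagged u) (tagged_as u v).
Lemma du_adj_sym : symmetric du_adj.
Proof.
move=> [i x] [j y]; rewrite /du_adj /= eq_sym.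
by case: eqP => //= e; subst j; rewrite !tagged_asE adj_sym.
Qed.
Lemma du_adj_irrefl : irreflexive du_adj.
Proof. by move=> [i x]; rewrite /du_adj /= tagged_asE adj_irrefl andbF. Qed.
Definition disjoint_union : sgraph := SGraph du_adj_sym du_adj_irrefl.
End DisjointUnion.

Section Induced.
Variables (G : sgraph) (S : {set G}).
Definition induced_adj : rel {x : G | x \in S} := fun x y => adj (val x) (val y).
Lemma induced_adj_sym : symmetric induced_adj.
Proof. by move=> x y; rewrite /induced_adj adj_sym. Qed.
Lemma induced_adj_irrefl : irreflexive induced_adj.
Proof. by move=> x; rewrite /induced_adj adj_irrefl. Qed.
Definition induced : sgraph := SGraph induced_adj_sym induced_adj_irrefl.
End Induced.

Definition edges (G : sgraph) : {set {set G}} :=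
  [set [set u.1; u.2] | u : G * G & adj u.1 u.2].

(* A (not necessarily induced) subgraph: a vertex set and a set of edges of G
   with endpoints in it. *)
Definition is_subgraph (G : sgraph) (S : {set G} * {set {set G}}) : bool :=
  (S.2 \subset edges G) && [forall e in S.2, e \subset S.1].

Definition subgraph (G : sgraph) := {S : {set G} * {set {set G}} | is_subgraph S}.

Section SubgraphGraph.
Variables (G : sgraph) (S : subgraph G).
Definition sub_verts : {set G} := (val S).1.
Definition sub_edges : {set {set G}} := (val S).2.
Definition sub_adj : rel {x : G | x \in sub_verts} :=
  fun x y => [set val x; val y] \in sub_edges.
Lemma sub_adj_sym : symmetric sub_adj.
Proof. by move=> x y; rewrite /sub_adj setUC. Qed.
Lemma sub_adj_irrefl : irreflexive sub_adj.
Proof.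
move=> x; rewrite /sub_adj setUid; apply/negP => xS.
have /andP[/subsetP/(_ _ xS)/imsetP[[y z]]] := valP S.
rewrite inE /= => yz /setP e _.
have := e y; have := e z; rewrite !inE !eqxx orbT /= => /eqP zx /eqP yx.
by rewrite zx yx adj_irrefl in yz.
Qed.
Definition graph_of_sub : sgraph := SGraph sub_adj_sym sub_adj_irrefl.
End SubgraphGraph.

Definition cliques (t : nat) (G : sgraph) : {set {set G}} :=
  [set S : {set G} | iso (induced S) (complete_graph t)].

Definition on_path (G : sgraph) (T : {set G}) (k : nat) : bool :=
  [exists S : subgraph G,
    (T \subset sub_verts S) && iso (graph_of_sub S) (path_graph k.+1)].

(* No path of G has more than #|G| vertices, so bounding k loses nothing; the
   value is 0 if no path of G contains T. *)
Definition beta (G : sgraph) (T : {set G}) : nat :=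
  \max_(k < #|G| | on_path T k) k.

Definition p (t : nat) (G : sgraph) (T : {set G}) : rat :=
  (1 / ('C(beta T, t.-1))%:R)%R.

(* Main.v *)
(** The bound is proved by induction on the vertex set A in which the paths
    and cliques live. Take a longest path of G[A], with k edges. If one of its
    ends v has at most k/2 neighbours, then all cliques T at v lie on that path,
    so beta(T) = k and they contribute at most C(k/2, t-1) / C(k, t-1) <= 1/t;
    delete v. Otherwise the path can be closed into a cycle, whose vertex set C
    is, by maximality, a union of components; the cliques inside C contribute at
    most C(k+1, t) / C(k, t-1) = (k+1)/t, with equality only if C is a clique;
    delete C. Deleting vertices only increases the weights. Equality never
    survives a deletion of the first kind: the rest would be a disjoint union of
    complete graphs, and v would lengthen the longest paths in one of them.
    Conversely, in a disjoint union of complete graphs of order at least t the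
    cliques containing a given vertex have total weight 1. *)

Require Import Defs.
From HB Require Import structures.
From mathcomp Require Import all_boot all_order all_algebra lra.
Import Order.TTheory GRing.Theory Num.Theory.

Set Implicit Arguments.
Unset Strict Implicit.
Unset Printing Implicit Defensive.

(** * Binomial estimates *)

(** Since [d.*2 - i >= 2 * (d - i)], doubling [d] multiplies the falling factorial by at least
    [2 ^ m], and [2 ^ m >= m.+1]. *)
Lemma leq_bin_double d k m : d.*2 <= k -> m.+1 * 'C(d, m) <= 'C(k, m).
Proof.
move=> le_dk; apply: leq_trans (leq_bin2l m le_dk).
apply: (@leq_trans (2 ^ m * 'C(d, m))); first by rewrite leq_mul2r ltn_expl ?orbT.
rewrite -(leq_pmul2r (fact_gt0 m)) -mulnA !bin_ffact.
elim: m => [|m IHm]; first by rewrite !ffactn0.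
rewrite !ffactnSr expnSr mulnACA leq_mul //.
by rewrite mulnBr mul2n leq_sub2l // leq_pmull.
Qed.

(** The term added by Pascal's rule is positive because [m <= a]. *)
Lemma ltn_bin2l a b m : 0 < m -> m <= a -> a < b -> 'C(a, m) < 'C(b, m).
Proof.
case: m => // m _ le_ma lt_ab.
apply: leq_trans (leq_bin2l _ lt_ab).
by rewrite binS -addn1 leq_add2l bin_gt0 ltnW.
Qed.

(** The case [c = 0] is covered by the convention that the inverse of 0 is 0. *)
Lemma ler_ratio_inv (F : numFieldType) (m N c : nat) :
  0 < m -> m * N <= c -> (N%:R / c%:R <= m%:R^-1 :> F)%R.
Proof.
move=> m0; have [->|c0] := posnP c.
  by rewrite invr0 mulr0 invr_ge0 ler0n.
by rewrite ler_pdivrMr ?ltr0n // ler_pdivlMl ?ltr0n // -natrM ler_nat.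
Qed.

(** * Paths and longest paths inside a vertex set *)

Section Paths.
Context {G : sgraph}.
Implicit Types (A B C T U : {set G}) (s : seq G).

Definition nbrs A x := [set y in A | adj x y].

Definition clique T := [forall x in T, forall y in T, (x != y) ==> adj x y].

Lemma cliqueP T : reflect {in T &, forall x y, x != y -> adj x y} (clique T).
Proof.
apply: (iffP forall_inP) => [h x y xT yT xy | h x xT].
  by have /forall_inP/(_ y yT)/implyP/(_ xy) := h x xT.
by apply/forall_inP => y yT; apply/implyP => xy; apply: h.
Qed.

Definition upath A s := [&& uniq s, sorted (@adj G) s & all (mem A) s].

(** [k] counts edges; tuples of a fixed length form a finite type, which makes the predicate
    boolean. *)
Definition path_through A T k :=
  [exists s : k.+1.-tuple G, upath A s && (T \subset s)].

(** The counterpart of [beta] for paths inside [A], with value 0 if none contains [T].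
    [maxpath A set0] is the length of a longest path of [G[A]]. *)
Definition maxpath A T := \max_(k < #|G| | path_through A T k) k.

Lemma path_throughP A T k :
  reflect (exists2 s, upath A s && (T \subset s) & size s = k.+1)
          (path_through A T k).
Proof.
apply: (iffP existsP) => [[s h] | [s h /eqP sz]].
  by exists s; rewrite ?size_tuple.
by exists (Tuple sz).
Qed.

Lemma path_through_lt A T k : path_through A T k -> k < #|G|.
Proof.
case/path_throughP => s /andP[/and3P[us _ _] _] <-.
by rewrite -(card_uniqP us) max_card.
Qed.

Lemma maxpath_ub A T k : path_through A T k -> k <= maxpath A T.
Proof.
move=> h; have lt_k := path_through_lt h.
exact: (@leq_bigmax_cond _ (fun k : 'I__ => path_through A T k) (@nat_of_ord _)
          (Ordinal lt_k)).
Qed.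

Lemma maxpath_ex A T k : path_through A T k -> path_through A T (maxpath A T).
Proof.
move=> h; have lt_k := path_through_lt h.
have [|i hi eq_i] :=
  @eq_bigmax_cond _ (fun k : 'I_#|G| => path_through A T k) (@nat_of_ord _).
  by apply/card_gt0P; exists (Ordinal lt_k).
by rewrite /maxpath eq_i.
Qed.

Lemma sub0_seq s : set0 \subset s.
Proof. by apply/subsetP => x; rewrite inE. Qed.

Lemma upath_size A T s : upath A s -> T \subset s -> size s <= (maxpath A T).+1.
Proof.
move=> ps Ts; case sz: (size s) => [//|k]; apply: maxpath_ub.
by apply/path_throughP; exists s; rewrite ?ps.
Qed.

Lemma upath_maxpath A T s : upath A s -> T \subset s -> 0 < size s ->
  exists2 s', upath A s' && (T \subset s') & size s' = (maxpath A T).+1.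
Proof.
move=> ps Ts; case sz: (size s) => [//|k] _; apply/path_throughP.
by apply: (@maxpath_ex _ _ k); apply/path_throughP; exists s; rewrite ?ps.
Qed.

Lemma upathS A B s : A \subset B -> upath A s -> upath B s.
Proof.
move=> /subsetP AB /and3P[us ps /allP As]; apply/and3P; split=> //.
by apply/allP => x /As; apply: AB.
Qed.

Lemma upath_rev A s : upath A (rev s) = upath A s.
Proof.
rewrite /upath rev_uniq all_rev rev_sorted; congr [&& _, _ & _].
by apply: eq_sorted => x y; rewrite adj_sym.
Qed.

Lemma adj_neq (x y : G) : adj x y -> x != y.
Proof. by apply: contraTneq => ->; rewrite adj_irrefl. Qed.

Lemma upath_clique A s : uniq s -> {subset s <= A} ->
  {in s &, forall x y, x != y -> adj x y} -> upath A s.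
Proof.
move=> us sA h; apply/and3P; split=> //; last by apply/allP.
apply: pairwise_sorted.
move: us; rewrite uniq_pairwise; apply: (@sub_in_pairwise _ (mem s) _ _ h).
by apply/allP => x.
Qed.

Lemma upath_enum A T : T \subset A -> clique T -> upath A (enum T).
Proof.
move=> /subsetP TA /cliqueP cT; apply: upath_clique; first exact: enum_uniq.
  by move=> x; rewrite mem_enum; apply: TA.
by move=> x y; rewrite !mem_enum; apply: cT.
Qed.

Lemma sub_enum T : T \subset enum T.
Proof. by apply/subsetP => x; rewrite mem_enum. Qed.

Lemma clique_maxpath A T : T \subset A -> clique T -> #|T| <= (maxpath A T).+1.
Proof.
by move=> TA cT; rewrite cardE; apply: upath_size (upath_enum TA cT) (sub_enum T).
Qed.

Lemma maxpathS A B T U : A \subset B -> U \subset T -> maxpath A T <= maxpath B U.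
Proof.
move=> AB UT; apply/bigmax_leqP => i /path_throughP[s /andP[ps Ts] sz].
apply: maxpath_ub; apply/path_throughP; exists s; rewrite // (upathS AB ps).
exact: subset_trans Ts.
Qed.

(* Rotating the cycle to a vertex with a neighbour outside of it would give
   a longer path. *)
Lemma longest_cycle_closed A s :
  upath A s -> cycle (@adj G) s -> size s = (maxpath A set0).+1 ->
  {in s & A, forall x y, adj x y -> y \in s}.
Proof.
move=> /and3P[us _ /allP sA] cs sz x y xs yA xy; apply: contraT => ys.
have [i s' rs] := rot_to xs.
have us' : uniq (x :: s') by rewrite -rs rot_uniq.
have mem_s' z : z \in x :: s' = (z \in s) by rewrite -rs mem_rot.
have : cycle (@adj G) (x :: s') by rewrite -rs rot_cycle.
rewrite /= rcons_path => /andP[ps' _].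
have : upath A (y :: x :: s').
  apply/and3P; split; first by rewrite cons_uniq mem_s' ys.
    by rewrite /= adj_sym xy.
  apply/allP => z; rewrite inE mem_s' => /predU1P[->//|]; exact: sA.
move/(@upath_size _ set0)/(_ (sub0_seq _)).
by rewrite -rs /= size_rot sz ltnn.
Qed.

(** A neighbour in [A] off the path could be put in front of it. *)
Lemma longest_head_nbrs A x s :
  upath A (x :: s) -> size s = maxpath A set0 -> {subset nbrs A x <= s}.
Proof.
move=> /and3P[us ps /allP sA] sz y; rewrite inE => /andP[yA xy].
apply: contraT => ys.
have : upath A (y :: x :: s).
  apply/and3P; split; last 1 first.
  - by apply/allP => z; rewrite inE => /predU1P[->//|]; apply: sA.
  - by rewrite cons_uniq inE negb_or ys eq_sym adj_neq.
  - by rewrite /= adj_sym xy.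
move/(@upath_size _ set0)/(_ (sub0_seq _)).
by rewrite /= sz ltnn.
Qed.

(** The cycle follows [a], jumps to the far end of [b], runs back to [z] and closes with the edge
    from [z] to [x]. *)
Lemma cycle_cross (x z : G) (a b : seq G) :
  path (@adj G) x (a ++ z :: b) -> adj x z -> adj (last x a) (last z b) ->
  cycle (@adj G) (x :: a ++ rev (z :: b)).
Proof.
rewrite cat_path /= => /and3P[pa _ pb] xz ab.
rewrite rcons_path cat_path pa last_cat; apply/andP; split; last first.
  by rewrite rev_cons last_rcons adj_sym.
rewrite lastI rev_rcons /= ab rev_path.
by rewrite (eq_path (e' := @adj G)) // => u v; rewrite adj_sym.
Qed.

(* Posa's crossing argument: if both ends of a longest path have more than
   k/2 neighbours, all of them on the path, then for some i the first vertex is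
   adjacent to the (i+1)-st one and the last vertex to the i-th one. *)
Lemma longest_path_cases A (k := maxpath A set0) : A != set0 ->
  (exists v s, [/\ upath A (v :: s), size s = k & #|nbrs A v|.*2 <= k]) \/
  (exists c, [/\ upath A c, size c = k.+1 & cycle (@adj G) c]).
Proof.
case/set0Pn => x0 x0A.
have p0 : upath A [:: x0] by rewrite /upath /= x0A.
have [[//|x s] /andP[ps _] [sz]] := upath_maxpath p0 (sub0_seq _) isT.
have [lowx|highx] := leqP #|nbrs A x|.*2 k; first by left; exists x, s.
(* The reversed path is also longest and starts at [y]. *)
set y := last x s; have ps' : upath A (y :: rev (belast x s)).
  by rewrite -rev_rcons -lastI upath_rev.
have sz' : size (rev (belast x s)) = k by rewrite size_rev size_belast.
have [lowy|highy] := leqP #|nbrs A y|.*2 k.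
  by left; exists y, (rev (belast x s)).
right; pose nb i := nth x (x :: s) i.
(* [I1] and [I2] lie in ['I_k] and have more than [k] elements in total, so they share an index. For
   [k = 1] the resulting cycle is an edge traversed both ways. *)
pose I1 := [set i : 'I_k | adj x (nb i.+1)].
pose I2 := [set i : 'I_k | adj y (nb i)].
have le1 : #|nbrs A x| <= #|I1|.
  apply: leq_trans (leq_imset_card (fun i : 'I_k => nb i.+1) I1).
  apply/subset_leq_card/subsetP => z zN.
  have zs := longest_head_nbrs ps sz zN.
  have lt_z : index z s < k by rewrite -[k]sz index_mem.
  apply/imsetP; exists (Ordinal lt_z); rewrite ?inE /nb /= nth_index //.
  by move: zN; rewrite inE => /andP[].
have le2 : #|nbrs A y| <= #|I2|.
  apply: leq_trans (leq_imset_card (fun i : 'I_k => nb i) I2).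
  apply/subset_leq_card/subsetP => z zN.
  have := longest_head_nbrs ps' sz' zN; rewrite mem_rev => zs.
  have lt_z : index z (belast x s) < k by rewrite -[k]sz -(size_belast x s) index_mem.
  have nb_z : nb (index z (belast x s)) = z.
    by rewrite /nb lastI nth_rcons index_mem zs nth_index.
  apply/imsetP; exists (Ordinal lt_z); rewrite ?inE /= nb_z //.
  by move: zN; rewrite inE => /andP[].
have /set0Pn[i] : I1 :&: I2 != set0.
  rewrite -card_gt0 -(ltn_add2l #|I1 :|: I2|) addn0 cardsUI.
  apply: leq_ltn_trans (leq_trans _ (leq_add le1 le2)).
    exact: leq_trans (max_card _) (eq_leq (card_ord k)).
  by rewrite -ltn_double doubleD -[k.*2]addnn -addSn leq_add // ltnW.
rewrite !inE => /andP[xz yw].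
have lt_i : i < size s by rewrite sz.
pose a := take i s; pose b := drop i.+1 s.
have def_s : s = a ++ nth x s i :: b by rewrite -drop_nth // cat_take_drop.
have last_a : last x a = nb i.
  rewrite /a (last_nth x) size_takel ?(ltnW lt_i) //.
  by rewrite -[x :: take i s]/(take i.+1 (x :: s)) nth_take.
exists (x :: a ++ rev (nth x s i :: b)).
have pm : perm_eq (x :: a ++ rev (nth x s i :: b)) (x :: s).
  by rewrite perm_cons {2}def_s perm_cat2l perm_rev.
case/and3P: ps => us ps sA.
have cyc : cycle (@adj G) (x :: a ++ rev (nth x s i :: b)).
  apply: cycle_cross => //; first by rewrite -def_s.
  by move: yw; rewrite last_a adj_sym /y {1}def_s last_cat.
split; [apply/and3P; split | by rewrite (perm_size pm) /= sz | by []].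
- by rewrite (perm_uniq pm).
- by move: cyc; rewrite /= rcons_path => /andP[].
by rewrite (perm_all _ pm).
Qed.

End Paths.

(** * Weights of cliques, and clusters *)

Section Clusters.
Context {G : sgraph} (t : nat) (t_gt1 : 1 < t).
Implicit Types (A B C T U : {set G}) (s : seq G).

Definition cliques_in A := [set T : {set G} | [&& T \subset A, clique T & #|T| == t]].

Definition weight A T : rat := ('C(maxpath A T, t.-1)%:R^-1)%R.

(** Encodes that [G[A]] is a disjoint union of complete graphs of order at least [t]: adjacency is
    transitive on distinct vertices, so [x] and its neighbours form the component of [x]. *)
Definition cluster A :=
  {in A & &, forall x y z, adj x y -> adj y z -> x != z -> adj x z} /\
  {in A, forall x, t <= #|nbrs A x|.+1}.

Let t_gt0 : 0 < t. Proof. exact: ltnW. Qed.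

Lemma nbrs_notin A x : x \notin nbrs A x.
Proof. by rewrite inE adj_irrefl andbF. Qed.

Lemma clique_neq0 A T : T \in cliques_in A -> 0 < #|T|.
Proof. by rewrite inE => /and3P[_ _ /eqP->]. Qed.

Lemma card_closed_nbrs A x : #|x |: nbrs A x| = #|nbrs A x|.+1.
Proof. by rewrite cardsU1 nbrs_notin. Qed.

(** A path enumerating [T] already has [t.-1] edges. *)
Lemma bin_maxpath_gt0 A T : T \in cliques_in A -> 0 < 'C(maxpath A T, t.-1).
Proof.
rewrite inE => /and3P[TA cT /eqP szT].
by rewrite bin_gt0 -ltnS prednK // -szT clique_maxpath.
Qed.

Lemma cliques_inS A B : A \subset B -> cliques_in A \subset cliques_in B.
Proof.
move=> AB; apply/subsetP => T; rewrite !inE => /and3P[TA -> ->].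
by rewrite (subset_trans TA AB).
Qed.

(** Paths in [A] remain paths in [B], so the denominator can only grow with the set. *)
Lemma weightS A B T : T \in cliques_in A -> A \subset B ->
  (weight B T <= weight A T)%R.
Proof.
move=> KT AB; have KT' := subsetP (cliques_inS AB) T KT.
by rewrite lef_pV2 ?posrE ?ltr0n ?bin_maxpath_gt0 // ler_nat leq_bin2l // maxpathS.
Qed.

Lemma star_sub A v : [set T in cliques_in A | v \in T] \subset
  [set v |: U | U in [set U : {set G} | U \subset nbrs A v & #|U| == t.-1]].
Proof.
apply/subsetP => T; rewrite !inE => /andP[/and3P[/subsetP TA /cliqueP cT /eqP szT] vT].
apply/imsetP; exists (T :\ v); last by rewrite setD1K.
rewrite inE; apply/andP; split.
  apply/subsetP => x; rewrite !inE => /andP[xv xT].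
  by rewrite TA // cT // eq_sym.
by rewrite -szT (cardsD1 v T) vT.
Qed.

Lemma card_star A v :
  #|[set T in cliques_in A | v \in T]| <= 'C(#|nbrs A v|, t.-1).
Proof.
apply: leq_trans (subset_leq_card (star_sub A v)) _.
by rewrite -cards_draws leq_imset_card.
Qed.

Lemma cluster_nbr A v : cluster A -> v \in A ->
  {in v |: nbrs A v &, forall x y, x != y -> adj x y}.
Proof.
move=> [tr _] vA x y; rewrite !inE => /predU1P[->|/andP[xA vx]].
  by move=> /predU1P[->|/andP[] //]; rewrite eqxx.
move=> /predU1P[->|/andP[yA vy]] xy; first by rewrite adj_sym.
by apply: (tr x v y) => //; rewrite adj_sym.
Qed.

(** In a cluster any [t.-1] neighbours of [v] form a clique with [v], so the inclusion [star_sub] is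
    an equality. *)
Lemma card_cluster_star A v : cluster A -> v \in A ->
  #|[set T in cliques_in A | v \in T]| = 'C(#|nbrs A v|, t.-1).
Proof.
move=> clA vA.
pose D := [set U : {set G} | U \subset nbrs A v & #|U| == t.-1].
have vD U : U \in D -> v \notin U.
  rewrite inE => /andP[/subsetP sU _]; apply: contra (nbrs_notin A v); exact: sU.
have <- : [set v |: U | U in D] = [set T in cliques_in A | v \in T].
  apply/eqP; rewrite eqEsubset star_sub andbT; apply/subsetP => _ /imsetP[U UD ->].
  have vU := vD U UD; move: UD; rewrite !inE eqxx => /andP[sU /eqP szU].
  rewrite cardsU1 vU szU add1n prednK // eqxx !andbT; apply/andP; split.
    rewrite subUset sub1set vA; apply: subset_trans sU _.
    by apply/subsetP => x; rewrite inE => /andP[].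
  apply/cliqueP => x y xU yU; apply: (cluster_nbr clA vA).
    exact: (subsetP (setUS _ sU)).
  exact: (subsetP (setUS _ sU)).
rewrite card_in_imset ?cards_draws // => U U' /vD vU /vD vU' eqU.
by rewrite -(setU1K vU) eqU setU1K.
Qed.

(** Induction along the path: transitivity passes adjacency with the head from its successor to all
    later vertices. *)
Lemma cluster_upath A s : cluster A -> upath A s ->
  {in s &, forall x y, x != y -> adj x y}.
Proof.
move=> [tr _]; elim: s => [//|x s IHs] /and3P[/= /andP[xs us] ps /andP[xA sA]].
have cs := IHs (introT and3P (And3 us (path_sorted ps) sA)).
suff xadj : {in s, forall z, adj x z}.
  move=> y z; rewrite !inE => /predU1P[->|ys] /predU1P[->|zs] yz.
  - by rewrite eqxx in yz.
  - exact: xadj.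
  - by rewrite adj_sym xadj.
  - exact: cs.
case: s ps xs us sA cs {IHs} => [//|y s] /= /andP[xy ps] xs us sA cs z zs.
have [-> //|yz] := eqVneq z y.
have sA' : {in y :: s, forall u, u \in A} by exact/allP.
apply: (tr x y z) => //; [exact: sA' (mem_head _ _) | exact: sA' | | ].
  by apply: cs; rewrite ?mem_head // eq_sym.
by apply: contraNneq xs => ->.
Qed.

(** A path through [v] stays in the closed neighbourhood of [v]; conversely this neighbourhood is a
    clique containing [T], so enumerating it gives a path. *)
Lemma cluster_maxpath A T v : cluster A -> T \in cliques_in A -> v \in T ->
  maxpath A T = #|nbrs A v|.
Proof.
move=> clA; rewrite inE => /and3P[TA cT /eqP szT] vT.
have vA := subsetP TA v vT.
have cN := cluster_nbr clA vA.
apply/eqP; rewrite eqn_leq -ltnS -[_ <= maxpath _ _]ltnS; apply/andP; split.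
  have [|s /andP[ps Ts] <-] := upath_maxpath (upath_enum TA cT) (sub_enum T).
    by rewrite -cardE szT.
  have cs := cluster_upath clA ps; case/and3P: ps => us _ /allP sA.
  rewrite -(card_uniqP us) -card_closed_nbrs.
  apply/subset_leq_card/subsetP => x xs.
  rewrite !inE; case: eqVneq => //= xv.
  by rewrite [x \in A]sA //=; apply: cs; rewrite // ?(subsetP Ts v) // eq_sym.
have NA : v |: nbrs A v \subset A.
  by rewrite subUset sub1set vA; apply/subsetP => x; rewrite inE => /andP[].
have TN : T \subset v |: nbrs A v.
  apply/subsetP => x xT; rewrite !inE; case: eqVneq => //= xv.
  by rewrite (subsetP TA) // (cliqueP _ cT) // eq_sym.
have := upath_size (upath_enum NA (introT (cliqueP _) cN))
  (subset_trans TN (sub_enum _)).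
by rewrite -cardE card_closed_nbrs.
Qed.

(** Double counting: each clique gives its weight to each of its [t] vertices, and a vertex with [d]
    neighbours receives ['C(d, t.-1)] shares of [1 / 'C(d, t.-1)]. *)
Lemma cluster_sum A : cluster A ->
  (\sum_(T in cliques_in A) weight A T = #|A|%:R / t%:R)%R.
Proof.
move=> clA; apply: (@mulIf _ (t%:R : rat)%R); first by rewrite pnatr_eq0 -lt0n.
rewrite divfK ?pnatr_eq0 -?lt0n // mulr_suml.
transitivity (\sum_(T in cliques_in A) \sum_(v in A | v \in T) weight A T)%R.
  apply: eq_bigr => T; rewrite inE => /and3P[/subsetP TA _ /eqP <-].
  rewrite mulr_natr -sumr_const; apply: eq_bigl => v.
  by case vT: (v \in T); rewrite ?andbF // TA.
rewrite (exchange_big_dep (mem A)) /=; last by move=> ? ? _ /andP[].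
rewrite -sum1_card natr_sum; apply: eq_bigr => v vA.
rewrite (eq_bigr (fun _ => ('C(#|nbrs A v|, t.-1)%:R^-1)%R)); last first.
  by move=> T /and3P[KT _ vT]; rewrite /weight (cluster_maxpath clA KT vT).
rewrite sumr_const.
have -> : #|[pred T in cliques_in A | (v \in A) && (v \in T)]|
   = 'C(#|nbrs A v|, t.-1).
  by rewrite -card_cluster_star //; apply: eq_card => T; rewrite !inE vA.
rewrite -[(_ *+ 'C(_, _))%R]mulr_natr mulVf // pnatr_eq0 -lt0n bin_gt0.
by rewrite -ltnS prednK //; case: clA => _; apply.
Qed.

(** * Splitting off a closed set of vertices *)

Lemma nbrsS A B x : A \subset B -> nbrs A x \subset nbrs B x.
Proof.
by move=> /subsetP AB; apply/subsetP => y; rewrite !inE => /andP[/AB -> ->].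
Qed.

Lemma cluster_split A C : C \subset A -> {in C & A, forall x y, adj x y -> y \in C} ->
  clique C -> t <= #|C| -> cluster (A :\: C) -> cluster A.
Proof.
move=> CA closedC /cliqueP cC tC [tr deg]; split=> [x y z xA yA zA xy yz xz | x xA].
  have [yC|yC] := boolP (y \in C).
    apply: cC => //; last exact: (closedC y z).
    by apply: (closedC y x); rewrite // adj_sym.
  have xC : x \notin C by apply: contra yC => xC; apply: (closedC x y).
  have zC : z \notin C.
    by apply: contra yC => zC; apply: (closedC z y); rewrite // adj_sym.
  by apply: (tr x y z) => //; rewrite inE ?xC ?yC ?zC.
have [xC|xC] := boolP (x \in C).
  apply: leq_trans tC _; rewrite -card_closed_nbrs.
  apply/subset_leq_card/subsetP => y yC; rewrite !inE; case: eqVneq => //= yx.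
  by rewrite (subsetP CA) // cC // eq_sym.
apply: (@leq_trans #|nbrs (A :\: C) x|.+1); first by apply: deg; rewrite inE xC.
exact: subset_leq_card (nbrsS x (subsetDl A C)).
Qed.

(** A clique meeting both [C] and the rest would contain an edge leaving [C]. *)
Lemma cliques_disconnected A C : {in C & A, forall x y, adj x y -> y \in C} ->
  [set T in cliques_in A | ~~ (T \subset C)] = cliques_in (A :\: C).
Proof.
move=> closedC; apply/setP => T; rewrite inE.
apply/andP/idP => [[] | KT]; last first.
  split; first exact: (subsetP (cliques_inS (subsetDl A C))).
  have /card_gt0P[x xT] := clique_neq0 KT.
  apply/subsetPn; exists x => //.
  by move: KT; rewrite inE => /andP[/subsetP/(_ x xT)]; rewrite inE => /andP[].
rewrite !inE => /and3P[/subsetP TA cT ->] /subsetPn[x xT xC].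
rewrite cT !andbT; apply/subsetP => y yT; rewrite inE TA // andbT.
apply: contra xC => yC; have [<- //|yx] := eqVneq y x.
by apply: (closedC y x); rewrite ?TA //; apply: (cliqueP _ cT).
Qed.

(** Two distinct vertices of [C] can be completed by [t.-2] others to a [t]-subset, which is a
    clique. *)
Lemma complete_of_card C : t <= #|C| ->
  [set T : {set G} | T \subset C & #|T| == t] \subset [set T | clique T] -> clique C.
Proof.
move=> tC /subsetP h; apply/cliqueP => x y xC yC xy.
pose r := [set T : {set G} | T \subset C :\: [set x; y] & #|T| == t.-2].
have xyC : [set x; y] \subset C by apply/subsetP => z /set2P[] ->.
have c2 : #|[set x; y]| = 2 by rewrite cards2 xy.
have : 0 < #|r|.
  by rewrite cards_draws bin_gt0 cardsD (setIidPr xyC) c2 -!subn2 leq_sub2r.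
case/card_gt0P => U; rewrite inE => /andP[/subsetP UC /eqP szU].
have disjU : [set x; y] :&: U = set0.
  by apply/setP => z; rewrite in_setI in_set0; apply/andP => -[zx /UC]; rewrite inE zx.
have /h : [set x; y] :|: U \in [set T : {set G} | T \subset C & #|T| == t].
  rewrite inE cardsU disjU cards0 subn0 c2 szU subUset xyC /=; apply/andP; split.
    by apply/subsetP => z /UC; rewrite inE => /andP[].
  by case: t t_gt1 => [|[]].
by rewrite inE => /cliqueP; apply=> //; rewrite !inE eqxx ?orbT.
Qed.

(** * Bounds for the deleted parts, and the induction *)

(** As [c] is a longest path, cliques on it have weight [1 / 'C(k, t.-1)]. There are at most
    ['C(k.+1, t)] of them, and [k.+1 * 'C(k, t.-1) = t * 'C(k.+1, t)]. Equality makes every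
    [t]-subset of [c] a clique. *)
Lemma sum_weight_cycle A c (k := maxpath A set0) :
  upath A c -> size c = k.+1 ->
  let S := (\sum_(T in cliques_in A | T \subset c) weight A T)%R in
  (S <= k.+1%:R / t%:R)%R /\
  (S = (k.+1%:R / t%:R)%R -> t <= k.+1 /\ clique [set x in c]).
Proof.
move=> pc szc S; have uc : uniq c by case/and3P: pc.
pose K := [set T in cliques_in A | T \subset c].
have szC : #|[set x in c]| = k.+1 by rewrite cardsE (card_uniqP uc).
have subC T : (T \subset c) = (T \subset [set x in c]).
  by apply/subsetP/subsetP => h x /h; rewrite inE.
have defS : S = (#|K|%:R / 'C(k, t.-1)%:R)%R.
  rewrite /S (eq_bigr (fun _ => 'C(k, t.-1)%:R^-1)%R).
    rewrite sumr_const mulr_natl; congr (_ *+ _)%R.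
    by apply: eq_card => T; rewrite [RHS]inE.
  move=> T /andP[KT Tc]; rewrite /weight; congr (_%:R^-1)%R; congr 'C(_, _).
  apply/eqP; rewrite eqn_leq maxpathS ?sub0set //=.
  by rewrite -ltnS -szc upath_size.
pose D := [set T : {set G} | T \subset [set x in c] & #|T| == t].
have KD : K \subset D.
  by apply/subsetP => T; rewrite !inE -subC => /andP[/and3P[_ _ ->] ->].
have leK : #|K| <= 'C(k.+1, t) by rewrite -szC -cards_draws subset_leq_card.
have binE : k.+1 * 'C(k, t.-1) = t * 'C(k.+1, t).
  by rewrite -{2 3}(prednK t_gt0) -mul_bin_diag.
have tn0 : (t%:R != 0 :> rat)%R by rewrite pnatr_eq0 -lt0n.
(* For [k < t.-1] the sum is 0 by the convention for inverses, while [k.+1 / t] is positive, so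
   equality cannot occur. *)
have [c0|c_gt0] := posnP 'C(k, t.-1).
  rewrite defS c0 invr0 mulr0 divr_ge0 ?ler0n //; split=> // /esym/eqP.
  by rewrite mulf_eq0 invr_eq0 !pnatr_eq0 -[t == 0]negbK -lt0n t_gt0.
have cn0 : ('C(k, t.-1)%:R != 0 :> rat)%R by rewrite pnatr_eq0 -lt0n.
rewrite defS; split.
  rewrite ler_pdivrMr ?ltr0n // mulrAC -natrM binE natrM mulrAC divff // mul1r.
  by rewrite ler_nat.
move/eqP; rewrite eqr_div // -!natrM binE [t * _]mulnC eqr_nat eqn_pmul2r // => /eqP eqK.
have tk : t <= k.+1 by rewrite -(prednK t_gt0) ltnS -bin_gt0.
split=> //; apply: complete_of_card; rewrite ?szC //.
have eqKD : K = D.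
  by apply/eqP; rewrite eqEcard KD cards_draws szC eqK leqnn.
apply/subsetP => T; rewrite -/D -eqKD => /setIdP[].
by rewrite !inE => /and3P[].
Qed.

Lemma sum_weight_end A v s : upath A (v :: s) -> size s = maxpath A set0 ->
  #|nbrs A v|.*2 <= maxpath A set0 ->
  (\sum_(T in cliques_in A | v \in T) weight A T <= t%:R^-1)%R.
Proof.
set k := maxpath A set0 => ps sz low.
rewrite (eq_bigr (fun _ => 'C(k, t.-1)%:R^-1)%R); last first.
  move=> T /andP[KT vT]; rewrite /weight; congr (_%:R^-1)%R; congr 'C(_, _).
  apply/eqP; rewrite eqn_leq maxpathS ?sub0set //= -/k -sz -ltnS.
  apply: (upath_size ps); apply/subsetP => x xT; rewrite inE.
  case: eqVneq => //= xv; apply: (longest_head_nbrs ps sz).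
  move: KT; rewrite !inE => /and3P[/subsetP TA /cliqueP cT _].
  by rewrite TA // cT // eq_sym.
rewrite sumr_const -[(_ *+ _)%R]mulr_natl; apply: ler_ratio_inv => //.
(* Taking [m = t.-1] in the binomial estimate produces the factor [t]. *)
have := leq_bin_double t.-1 low; rewrite prednK //; apply: leq_trans.
rewrite leq_mul2l; apply/orP; right; apply: leq_trans (card_star A v).
by apply: eq_leq; apply: eq_card => T; rewrite [RHS]inE.
Qed.

Lemma cliques_delete A v : [set T in cliques_in A | v \notin T] = cliques_in (A :\ v).
Proof.
apply/setP => T; rewrite !inE; case vT: (v \in T); rewrite ?andbF ?andbT /=.
  apply/esym/negbTE; rewrite negb_and; apply/orP; left.
  by apply/subsetPn; exists v; rewrite // !inE eqxx.
by rewrite subsetD1 vT andbT.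
Qed.

(* Joining v to a vertex w of a cluster lengthens the longest paths through
   the cliques at w, so the deletion of v cannot preserve their weights. *)
Lemma sum_weight_delete_lt A v w : v \in A -> w \in A -> adj v w ->
  cluster (A :\ v) ->
  (\sum_(T in cliques_in (A :\ v)) weight A T <
   \sum_(T in cliques_in (A :\ v)) weight (A :\ v) T)%R.
Proof.
move=> vA wA vw clB; set B := A :\ v in clB *.
have BA : B \subset A := subsetDl A _.
have wB : w \in B by rewrite !inE wA eq_sym adj_neq.
have deg : t <= #|nbrs B w|.+1 by case: clB => _; apply.
(* The degree condition provides a clique [T] at [w]; the inequality will be strict for [T] and weak
   for the others. *)
have : 0 < #|[set T in cliques_in B | w \in T]|.
  by rewrite card_cluster_star // bin_gt0 -ltnS prednK.
case/card_gt0P => T; rewrite inE => /andP[KT wT].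
rewrite (bigD1 T) //= [X in (_ < X)%R](bigD1 T) //=; apply: ltr_leD; last first.
  by apply: ler_sum => U /andP[KU _]; apply: weightS.
have KT' := subsetP (cliques_inS BA) T KT.
rewrite ltf_pV2 ?posrE ?ltr0n ?bin_maxpath_gt0 // ltr_nat.
move: (KT); rewrite inE => /and3P[TB cT /eqP szT].
apply: ltn_bin2l; first by rewrite -ltnS prednK.
  by rewrite -ltnS prednK // -szT clique_maxpath.
have [|s /andP[ps Ts] szs] := upath_maxpath (upath_enum TB cT) (sub_enum T).
  by rewrite -cardE szT.
have ws : w \in s := subsetP Ts w wT.
have cs := cluster_upath clB ps.
case/and3P: ps => us _ /allP sB.
(* The vertices of this longest path are pairwise adjacent, so they can be reordered to start at
   [w], and [v] can then be prepended. *)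
have ps' : upath A (w :: rem w s).
  have mem_ws : w :: rem w s =i s by move=> x; rewrite (perm_mem (perm_to_rem ws)).
  apply: upath_clique.
  - by rewrite -(perm_uniq (perm_to_rem ws)).
  - by move=> x; rewrite mem_ws => /sB; apply: (subsetP BA).
  - by move=> x y; rewrite !mem_ws; apply: cs.
have vs : v \notin s by apply/negP => /sB; rewrite /= !inE eqxx.
have : upath A (v :: w :: rem w s).
  case/and3P: ps' => us' ps' sA; apply/and3P; split.
  - by rewrite cons_uniq us' -(perm_mem (perm_to_rem ws)) vs.
  - by rewrite /= vw.
  - by apply/andP.
move/(@upath_size _ _ T); rewrite /= -[(size _).+1]/(size (w :: rem w s)).
rewrite -(perm_size (perm_to_rem ws)) szs ltnS; apply.
apply/subsetP => x /(subsetP Ts); rewrite inE (perm_mem (perm_to_rem ws)) => ->.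
by rewrite orbT.
Qed.

Lemma sum_weight A :
  (\sum_(T in cliques_in A) weight A T <= #|A|%:R / t%:R)%R /\
  ((\sum_(T in cliques_in A) weight A T = #|A|%:R / t%:R)%R -> cluster A).
Proof.
have [n] := ubnP #|A|; elim: n A => // n IHn A; rewrite ltnS => leAn.
have tinv : (0 < t%:R^-1 :> rat)%R by rewrite invr_gt0 ltr0n.
have [A0|An0] := eqVneq A set0.
  have -> : cliques_in A = set0.
    apply/setP => T; rewrite in_set0; apply/negP => KT.
    have := clique_neq0 KT; move: KT; rewrite inE => /andP[TA _].
    by move: TA; rewrite A0 subset0 => /eqP->; rewrite cards0.
  rewrite big_set0 A0 cards0 mul0r; split=> // _.
  by split=> [x y z|x]; rewrite inE.
have [[v [s [ps sz low]]]|[c [pc szc cyc]]] := longest_path_cases An0.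
  have vA : v \in A by case/and3P: ps => _ _ /andP[].
  have cardA := cardsD1 v A; rewrite vA in cardA.
  have [|le2 cl2] := IHn (A :\ v); first by rewrite (leq_trans _ leAn) // cardA.
  have le1 := sum_weight_end ps sz low.
  have split_sum : (\sum_(T in cliques_in A) weight A T =
      \sum_(T in cliques_in A | v \in T) weight A T +
      \sum_(T in cliques_in (A :\ v)) weight A T)%R.
    rewrite (bigID (fun T => v \in T)) /=; congr (_ + _)%R.
    by rewrite -cliques_delete; apply: eq_bigl => T; rewrite !inE.
  have le3 : (\sum_(T in cliques_in (A :\ v)) weight A T <=
              \sum_(T in cliques_in (A :\ v)) weight (A :\ v) T)%R.
    by apply: ler_sum => T KT; apply: weightS => //; apply: subsetDl.
  rewrite split_sum cardA natrD mulrDl mul1r; split; first by lra.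
  (* Equality makes all three estimates tight. The cliques at [v] then have positive total weight,
     so one exists; as [t >= 2] it contains some [w] other than [v], and [sum_weight_delete_lt]
     contradicts tightness of [le3]. *)
  move=> eqs; have clB : cluster (A :\ v) by apply: cl2; lra.
  have : (\sum_(T in cliques_in A | v \in T) weight A T)%R != 0%R.
    by rewrite gt_eqF //; lra.
  have [T /andP[KT vT] _ | nT] := pickP (fun T => (T \in cliques_in A) && (v \in T));
    last by rewrite big_pred0 ?eqxx.
  move: KT; rewrite inE => /and3P[/subsetP TA /cliqueP cT /eqP szT].
  have : 0 < #|T :\ v| by move: t_gt1; rewrite -szT (cardsD1 v) vT.
  case/card_gt0P => w; rewrite !inE => /andP[wv wT].
  have := sum_weight_delete_lt vA (TA w wT) _ clB.
  rewrite cT // 1?eq_sym // => /(_ isT) lts; exfalso; lra.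
pose C := [set x in c].
have CA : C \subset A.
  by case/and3P: pc => _ _ /allP cA; apply/subsetP => x; rewrite inE => /cA.
have closedC : {in C & A, forall x y, adj x y -> y \in C}.
  move=> x y; rewrite !inE; exact: (longest_cycle_closed pc cyc szc).
have szC : #|C| = (maxpath A set0).+1.
  by rewrite cardsE -szc; apply/card_uniqP; case/and3P: pc.
have cardA : #|A| = #|C| + #|A :\: C| by rewrite -(cardsID C A) (setIidPr CA).
have [|le2 cl2] := IHn (A :\: C).
  by rewrite (leq_trans _ leAn) // cardA szC addSn ltnS leq_addl.
have [le1 eq1] := sum_weight_cycle pc szc.
have split_sum : (\sum_(T in cliques_in A) weight A T =
    \sum_(T in cliques_in A | T \subset c) weight A T +
    \sum_(T in cliques_in (A :\: C)) weight A T)%R.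
  rewrite (bigID (fun T : {set G} => T \subset c)) /=; congr (_ + _)%R.
  rewrite -cliques_disconnected //; apply: eq_bigl => T; rewrite !inE.
  congr (_ && ~~ _).
  by apply/subsetP/subsetP => h x /h; rewrite inE.
have le3 : (\sum_(T in cliques_in (A :\: C)) weight A T <=
            \sum_(T in cliques_in (A :\: C)) weight (A :\: C) T)%R.
  by apply: ler_sum => T KT; apply: weightS => //; apply: subsetDl.
rewrite split_sum cardA szC natrD mulrDl; split; first by lra.
(* Equality must hold for both parts: [C] is a large enough clique and the rest is a cluster. *)
move=> eqs; have [tC cC] := eq1 ltac:(lra).
by apply: (cluster_split CA closedC) => //; rewrite ?szC //; apply: cl2; lra.
Qed.

End Clusters.

(** * Cliques, paths and weights as defined in the statement *)

Section Translation.
Context {G : sgraph} (t : nat).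
Implicit Types (T : {set G}) (s : seq G).

Lemma cliquesE : cliques t G = cliques_in t [set: G].
Proof.
apply/setP => T; rewrite !inE subsetT /=.
apply/isoP/andP => [[f [bf ef]]|[/cliqueP cT szT]].
  split; last first.
    by have := bij_eq_card bf; rewrite card_sig card_ord => <-; apply/eqP/eq_card.
  apply/cliqueP => x y xT yT xy.
  have := ef (exist _ x xT) (exist _ y yT); rewrite /= /induced_adj /= => <-.
  by rewrite /complete_adj; apply: contra_neq xy => /(bij_inj bf)[].
have e : #|{: {x : G | x \in T}}| = t by rewrite card_sig -(eqP szT); apply: eq_card.
have bij_f : bijective (fun x : {x : G | x \in T} => cast_ord e (enum_rank x)).
  apply: inj_card_bij; first by move=> x y /cast_ord_inj/enum_rank_inj.
  by rewrite card_ord -{1}e.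
exists (fun x => cast_ord e (enum_rank x)); split=> // x y.
rewrite /= /complete_adj (inj_eq (bij_inj bij_f)) /induced_adj.
have [->|xy] := eqVneq x y; first by rewrite adj_irrefl.
by rewrite cT ?(valP x) ?(valP y) // (inj_eq val_inj).
Qed.

(** A subgraph yields the sequence of its vertices read along the isomorphism; a sequence yields the
    subgraph of its consecutive edges. *)
Lemma on_pathE T k : on_path T k = path_through [set: G] T k.
Proof.
apply/existsP/path_throughP => [[S /andP[TS /isoP[f [[g fK gK] ef]]]] | [s]].
  have sub_adjW (x y : graph_of_sub S) : adj x y -> adj (val x) (val y).
    rewrite /= /sub_adj => xy; have /andP[/subsetP/(_ _ xy)/imsetP[[u v]]] := valP S.
    rewrite inE /= => uv e _.
    have /set2P[] : val x \in [set u; v] by rewrite -e set21.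
      move=> xu; have /set2P[] : v \in [set val x; val y] by rewrite e set22.
        by move=> vx; rewrite vx xu adj_irrefl in uv.
      by move=> <-; rewrite xu.
    move=> xv; have /set2P[] : u \in [set val x; val y] by rewrite e set21.
      by move=> ux; rewrite ux xv adj_irrefl in uv.
    by move=> <-; rewrite xv adj_sym.
  (* [inord] extends [g] to all naturals; only indices up to [k] are read. *)
  pose h i : G := val (g (inord i)).
  exists (mkseq h k.+1); last by rewrite size_mkseq.
  apply/andP; split.
    apply/and3P; split; last by apply/allP => x _; rewrite /= inE.
      apply/mkseq_uniqP => i j lt_i lt_j /val_inj/(can_inj gK)/(congr1 (@nat_of_ord _)).
      by rewrite !inordK.
    apply/(sortedP (h 0)) => i; rewrite size_mkseq => lt_i.
    rewrite !nth_mkseq ?(ltnW lt_i) //; apply: sub_adjW.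
    by rewrite -ef !gK /= /path_adj !inordK ?eqxx ?(ltnW lt_i).
  apply/subsetP => x xT; have xS := subsetP TS x xT.
  apply/mapP; exists (nat_of_ord (f (exist _ x xS))); first by rewrite mem_iota /=.
  by rewrite /h inord_val fK.
move=> /andP[/and3P[us ps _] /subsetP Ts] sz.
(* Only consecutive vertices are joined: a chord would destroy the isomorphism with the path. *)
pose E := [set [set u.1; u.2] | u : G * G &
   [&& u.1 \in s, u.2 \in s & (index u.1 s).+1 == index u.2 s]].
have subE : is_subgraph ([set x in s], E).
  apply/andP; split=> /=.
    apply/subsetP => e /imsetP[[u v]]; rewrite inE /= => /and3P[uS vS /eqP uv] ->.
    apply/imsetP; exists (u, v) => //; rewrite inE /=.
    have lt_v : (index u s).+1 < size s by rewrite uv index_mem.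
    have := sortedP u ps _ lt_v.
    by rewrite nth_index // uv nth_index.
  apply/forall_inP => e /imsetP[[u v]]; rewrite inE /= => /and3P[uS vS _] ->.
  by apply/subsetP => x /set2P[]->; rewrite inE.
exists (exist (fun S => is_subgraph S) _ subE); apply/andP; split.
  by apply/subsetP => x /Ts; rewrite inE.
have val_s (x : {x : G | x \in [set x in s]}) : val x \in s.
  by have := valP x; rewrite inE.
have lt_f (x : {x : G | x \in [set x in s]}) : index (val x) s < k.+1.
  by rewrite -sz index_mem val_s.
have inj_f : injective (fun x => Ordinal (lt_f x)).
  move=> x y [exy]; apply: val_inj.
  exact: (index_inj (val x) (val_s x) (val_s y) exy).
apply/isoP; exists (fun x => Ordinal (lt_f x)); split.
  apply: inj_card_bij => //; rewrite card_ord card_sig -sz -(card_uniqP us).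
  by apply: eq_leq; apply: eq_card => x; rewrite !inE.
move=> x y; rewrite /= /path_adj /sub_adj /=.
apply/orP/imsetP => [[/eqP xy|/eqP yx] | [[u v]]].
- by exists (val x, val y); rewrite // inE /= !val_s xy eqxx.
- by exists (val y, val x); rewrite 1?setUC // inE /= !val_s yx eqxx.
rewrite inE /= => /and3P[us' vs' /eqP uv] e.
have uNv : u != v by apply: contra_eqN uv => /eqP->; rewrite neq_ltn ltnSn orbT.
have /set2P[xE|xE] : val x \in [set u; v] by rewrite -e set21.
  have /set2P[vE|vE] : v \in [set val x; val y] by rewrite e set22.
    by rewrite vE xE eqxx in uNv.
  by left; rewrite xE -vE uv.
have /set2P[uE|uE] : u \in [set val x; val y] by rewrite e set21.
  by rewrite uE xE eqxx in uNv.
by right; rewrite xE -uE uv.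
Qed.

Lemma betaE T : beta T = maxpath [set: G] T.
Proof. by apply: eq_bigl => k; rewrite on_pathE. Qed.

Lemma pE T : p t T = weight t [set: G] T.
Proof. by rewrite /p betaE div1r. Qed.

(** * Clusters and disjoint unions of complete graphs *)

Lemma du_completeE (I : finType) (m : I -> nat)
    (u v : disjoint_union (fun i => complete_graph (m i))) :
  adj u v = (tag u == tag v) && (u != v).
Proof.
case: u v => i a [j b]; rewrite /= /du_adj /=; case: eqP => //= eij.
by subst j; rewrite tagged_asE /complete_adj eq_Tagged.
Qed.

Lemma cluster_of_iso r (m : 'I_r -> nat) : (forall i, t <= m i) ->
  iso G (disjoint_union (fun i => complete_graph (m i))) ->
  cluster t [set: G].
Proof.
move=> tm /isoP[f [[g fK gK] ef]]; split=> [x y z _ _ _ | x _].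
  rewrite -!ef !du_completeE => /andP[/eqP-> _] /andP[-> _] xz.
  by rewrite (inj_eq (can_inj fK)).
apply: leq_trans (tm (tag (f x))) _.
rewrite -card_closed_nbrs.
(* [h] embeds the block of [f x], of order at least [t], into the closed neighbourhood of [x]. *)
pose h (j : 'I_(m (tag (f x)))) := g (Tagged (fun i => complete_graph (m i)) j).
have inj_h : injective h by move=> j j' /(can_inj gK)/eqP; rewrite eq_Tagged => /eqP.
rewrite -[m _]card_ord -cardsT -(card_imset _ inj_h); apply/subset_leq_card/subsetP.
move=> _ /imsetP[j _ ->]; rewrite !inE; case: eqVneq => //= hx.
by rewrite -ef du_completeE gK eqxx /= -(inj_eq (can_inj gK)) fK eq_sym.
Qed.

(** The closed neighbourhoods partition the vertices into cliques; a vertex corresponds to its block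
    together with its rank there. *)
Lemma iso_of_cluster : cluster t [set: G] ->
  exists (r : nat) (m : 'I_r -> nat), (forall i, t <= m i) /\
    iso G (disjoint_union (fun i => complete_graph (m i))).
Proof.
move=> clG; pose B x := x |: nbrs [set: G] x.
have BP x y : (y \in B x) = (x == y) || adj x y by rewrite !inE eq_sym.
have adjB x y z : y \in B x -> z \in B x -> adj y z = (y != z).
  move=> yB zB; have [->|yz] := eqVneq y z; first exact: adj_irrefl.
  exact: (cluster_nbr clG (in_setT x)).
have eqB x y : y \in B x -> B x = B y.
  move=> xy; apply/setP => z; rewrite [RHS]BP; apply/idP/idP => [xz|].
    by rewrite (adjB x) // orbN.
  case/predU1P => [<- // | yz]; rewrite BP.
  have yx : x \in B y by rewrite BP eq_sym adj_sym -BP.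
  by rewrite (adjB y) ?orbN // BP yz orbT.
pose P := B @: [set: G].
pose Bl (i : 'I_#|P|) : {set G} := enum_val i.
have BlP i x : x \in Bl i -> Bl i = B x.
  by have /imsetP[y _] := enum_valP i; rewrite /Bl => ->; apply: eqB.
exists #|P|, (fun i => #|Bl i|); split=> [i|].
  have /imsetP[y _ eqi] := enum_valP i; rewrite /Bl eqi.
  by rewrite card_closed_nbrs; case: clG => _; apply; rewrite inE.
pose g (u : disjoint_union (fun i => complete_graph #|Bl i|)) : G :=
  enum_val (tagged u).
have gB u : g u \in Bl (tag u) by apply: enum_valP.
have tagB u v : g v \in B (g u) -> tag u = tag v.
  move/eqB => e; apply: enum_val_inj.
  by rewrite -![enum_val _]/(Bl _) (BlP _ _ (gB u)) (BlP _ _ (gB v)).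
have inj_g : injective g.
  move=> u v e; have := @tagB u v; rewrite e BP eqxx => /(_ isT).
  case: u v e => i a [j b] /= e eij; subst j.
  by congr existT; apply: enum_val_inj.
have surj_g x : exists u, g u == x.
  have PB : B x \in P by apply: imset_f; rewrite inE.
  have xB : x \in Bl (enum_rank_in PB (B x)) by rewrite /Bl enum_rankK_in // BP eqxx.
  exists (Tagged (fun i => complete_graph #|Bl i|) (enum_rank_in xB x)).
  by rewrite /g /= enum_rankK_in.
pose f x := xchoose (surj_g x).
have fK : cancel f g by move=> x; apply/eqP/(xchooseP (surj_g x)).
apply/isoP; exists f; split; first by exists g => // u; apply: inj_g; rewrite fK.
move=> x y; rewrite -{2}(fK x) -{2}(fK y) du_completeE.
move: (f x) (f y) => u v; rewrite -(inj_eq inj_g).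
have [e|ne] /= := eqVneq (tag u) (tag v).
  rewrite (adjB (g u)) //; first by rewrite BP eqxx.
  by rewrite -(BlP (tag u)) // e.
by apply/esym/negP => uv; case/eqP: ne; apply: tagB; rewrite BP uv orbT.
Qed.

End Translation.

Theorem theorem4p2 (G : sgraph) (n t : nat) (hn : #|G| = n) (ht : (2 <= t)%N) :
  (* beta is a genuine maximum and the denominator of p is nonzero *)
  (forall T : {set G}, T \in cliques t G ->
     [/\ on_path T (beta T),
         forall k : nat, on_path T k -> (k <= beta T)%N
       & 'C(beta T, t.-1) <> 0%N]) /\
  (* p is a decreasing function of beta, also across graphs *)
  (forall (H : sgraph) (T : {set G}) (U : {set H}),
     T \in cliques t G -> U \in cliques t H ->
     (beta T < beta U)%N -> (p t U < p t T)%R) /\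
  (\sum_(T in cliques t G) p t T <= n%:R / t%:R)%R /\
  ((\sum_(T in cliques t G) p t T = n%:R / t%:R)%R <->
   exists (r : nat) (m : 'I_r -> nat),
     (forall i : 'I_r, (t <= m i)%N) /\
     iso G (disjoint_union (fun i : 'I_r => complete_graph (m i)))).
Proof.
have t0 : 0 < t := ltnW ht.
split=> [T|].
  rewrite betaE cliquesE => KT; split=> [|k|].
  - rewrite on_pathE; have := KT; rewrite inE => /and3P[TA cT /eqP szT].
    (* Enumerating [T] gives a path with [t.-1] edges, so the maximum is attained and is not the
       default value. *)
    apply: (@maxpath_ex _ _ _ t.-1); apply/path_throughP; exists (enum T).
      by rewrite upath_enum ?sub_enum.
    by rewrite -cardE szT prednK.
  - by rewrite on_pathE; apply: maxpath_ub.
  - by apply/eqP; rewrite -lt0n (bin_maxpath_gt0 ht KT).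
split=> [H T U|].
  rewrite !cliquesE !pE !betaE => KT KU lt_TU.
  rewrite ltf_pV2 ?posrE ?ltr0n ?(bin_maxpath_gt0 ht KT) ?(bin_maxpath_gt0 ht KU) //.
  (* Strictness needs [0 < t.-1], from [2 <= t], and [t.-1 <= beta T], from the nonzero binomial
     coefficient. *)
  rewrite ltr_nat; apply: ltn_bin2l => //; first by rewrite -ltnS prednK.
  by rewrite -bin_gt0 (bin_maxpath_gt0 ht KT).
have [le_sum eq_sum] := sum_weight ht [set: G].
have eq_W : (\sum_(T in cliques t G) p t T =
             \sum_(T in cliques_in t [set: G]) weight t [set: G] T)%R.
  by rewrite cliquesE; apply: eq_bigr => T _; rewrite pE.
rewrite eq_W -hn -cardsT; split=> //; split=> [/eq_sum /iso_of_cluster //|].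
by move=> [r [m [tm isoG]]]; apply: cluster_sum => //; apply: cluster_of_iso isoG.
Qed.
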